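(* Let $\Omega$ be an infinite set. The following statements hold: (1) For any cardinals $\alpha,\beta$ with $\alpha\cdot\beta<|\Omega|$, none of the sets $W_{\alpha,\beta}(\Omega)$, $R_{\alpha,\beta}(\Omega)$, $K_{\alpha,\beta}(\Omega)$, $S_{\alpha,\beta}(\Omega)$ is a generating set for the group $S(\Omega)$. (2) For any cardinal $\alpha\leq|\Omega|$, each of the sets $W_{\alpha,|\Omega|}(\Omega)$, $R_{\alpha,|\Omega|}(\Omega)$, $K_{\alpha,|\Omega|}(\Omega)$, $S_{\alpha,|\Omega|}(\Omega)$ is a generating set for $S(\Omega)$. (3) For any cardinal $\beta\leq|\Omega|$, each of the sets $W_{|\Omega|,\beta}(\Omega)$, $R_{|\Omega|,\beta}(\Omega)$, $K_{|\Omega|,\beta}(\Omega)$, $S_{|\Omega|,\beta}(\Omega)$ is a generating set for $S(\Omega)$.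
   Context: $S(\Omega)$ is the group of all bijections $\Omega\to\Omega$. For $f\in S(\Omega)$, a subset $U\subset\Omega$ is an $f$-eigenspace if $f(x)\in U$ for all $x\in U$, and $M_f=\{x\in\Omega\mid f(x)\neq x\}$ is the set of non-fixed elements of $f$. For cardinals $\alpha,\beta$: - $W_{\alpha,\beta}(\Omega)$ is the set of all $f\in S(\Omega)$ such that $M_f$ is a disjoint union of at most $\alpha$ $f$-eigenspaces, each of cardinality at most $\beta$; - $K_{\alpha,\beta}(\Omega)$ is the set of all $f\in S(\Omega)$ such that $M_f$ is a disjoint union of $\alpha$ $f$-eigenspaces, each of cardinality at most $\beta$; - $R_{\alpha,\beta}(\Omega)$ is the set of all $f\in S(\Omega)$ such that $M_f$ is a disjoint union of at most $\alpha$ $f$-eigenspaces, each of cardinality equal to $\beta$; - $S_{\alpha,\beta}(\Omega)$ is the set of all $f\in S(\Omega)$ such that $M_f$ is a disjoint union of $\alpha$ $f$-eigenspaces, each of cardinality equal to $\beta$. A subset is a generating set for $S(\Omega)$ if the smallest subgroup containing it is $S(\Omega)$.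
   Formalization: Part (2) is stated for α ≥ 1 and part (3) for β ≥ 2: for α = 0, or for β ≤ 1, every f in the four sets has empty M_f, so the sets are contained in {id} and cannot generate S(Ω). *)

(* Defs.v *)
From mathcomp Require Import all_boot.
From mathcomp Require Import boolp classical_sets functions cardinality.

Set Implicit Arguments.
Unset Strict Implicit.
Unset Printing Implicit Defensive.

Local Open Scope classical_set_scope.
Local Open Scope card_scope.

(* There is no type of cardinals in the library: a cardinal is given by an
   arbitrary type alpha, standing for the cardinality of [set: alpha]. Thus
   |Omega| is Omega itself, and the product of two cardinals is the product
   type. *)

Definition card_lt (T U : Type) (A : set T) (B : set U) : Prop :=
  A #<= B /\ A #!= B.

Section SymmetricGroup.
Variable Omega : Type.
Implicit Types (f g : Omega -> Omega) (H X : set (Omega -> Omega)).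

Definition sym : set (Omega -> Omega) := [set f | bijective f].

Definition is_subgroup H : Prop :=
  [/\ H `<=` sym,
      H id,
      forall f g, H f -> H g -> H (f \o g) &
      forall f g, H f -> cancel f g -> cancel g f -> H g].

Definition generates X : Prop := smallest is_subgroup X = sym.

Definition moved f : set Omega := [set x | f x <> x].

Definition eigenspace f (U : set Omega) : Prop := forall x, U x -> U (f x).

(* The pieces form a set P of pairwise disjoint sets, so they are pairwise
   distinct and "alpha eigenspaces" below means that P has cardinality alpha.
   The empty set is an eigenspace, hence an admissible piece. *)
Definition eigen_decomposition f (P : set (set Omega)) : Prop :=
  [/\ trivIset P id,
      forall U, P U -> eigenspace f U &
      moved f = \bigcup_(U in P) U].

Variables alpha beta : Type.

Definition W_ : set (Omega -> Omega) := [set f | sym f /\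
  exists P, [/\ eigen_decomposition f P, P #<= [set: alpha] &
                forall U, P U -> U #<= [set: beta]]].

Definition K_ : set (Omega -> Omega) := [set f | sym f /\
  exists P, [/\ eigen_decomposition f P, P #= [set: alpha] &
                forall U, P U -> U #<= [set: beta]]].

Definition R_ : set (Omega -> Omega) := [set f | sym f /\
  exists P, [/\ eigen_decomposition f P, P #<= [set: alpha] &
                forall U, P U -> U #= [set: beta]]].

Definition S_ : set (Omega -> Omega) := [set f | sym f /\
  exists P, [/\ eigen_decomposition f P, P #= [set: alpha] &
                forall U, P U -> U #= [set: beta]]].

End SymmetricGroup.

Arguments sym Omega : clear implicits.
Arguments W_ Omega alpha beta : clear implicits.
Arguments K_ Omega alpha beta : clear implicits.
Arguments R_ Omega alpha beta : clear implicits.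
Arguments S_ Omega alpha beta : clear implicits.

(* Main.v *)
(* (1) Elements of W move at most alpha * beta points, and the permutations
   moving fewer than |Omega| points form a proper subgroup.

   (2), (3) It suffices to treat S, the smallest set. Write Omega as
   alpha * beta, by |Omega| * |Omega| = |Omega|, and let q act on every fibre
   {a} * beta by a fixed derangement; all conjugates of q lie in S. A set A of
   size |Omega| is disjoint from q A, so the commutators of q with permutations
   supported in A act as s^-1 on A and as s on q A, for arbitrary s. A swindle
   over countably many copies cancels everything but one s: the group generated
   by S contains every permutation with |Omega| fixed points, and every
   permutation is a product of two of those. *)
Require Import Defs.
From mathcomp Require Import all_boot.
From mathcomp Require Import boolp classical_sets functions cardinality.

Set Implicit Arguments.
Unset Strict Implicit.
Unset Printing Implicit Defensive.

Local Open Scope classical_set_scope.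
Local Open Scope card_scope.

(** * Cardinal arithmetic *)

Lemma fun_choice (S U : Type) (P : S -> U -> Prop) :
  (forall x, exists y, P x y) -> exists f : S -> U, forall x, P x (f x).
Proof. by move=> /choice[f fP]; exists f. Qed.

Lemma inj_surj_bijective (S U : Type) (f : S -> U) :
  injective f -> (forall y, exists x, f x = y) -> bijective f.
Proof.
move=> fI /choice[g gK]; exists g => // x.
exact/fI/gK.
Qed.

Lemma injfun_card_le (S U : Type) (A : set S) (B : set U) (f : S -> U) :
  (forall x, A x -> B (f x)) ->
  (forall x y, A x -> A y -> f x = f y -> x = y) -> A #<= B.
Proof.
move=> fAB fI; suff [g] : $|{injfun A >-> B}| by exact: inj_card_le g.
apply/injfunPex; exists f => // x y /set_mem Ax /set_mem Ay; exact: fI.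
Qed.

Lemma card_le_injfun (S U : Type) (u0 : U) (A : set S) (B : set U) :
  A #<= B -> exists f : S -> U,
    (forall x, A x -> B (f x)) /\
    (forall x y, A x -> A y -> f x = f y -> x = y).
Proof.
elim/Ppointed: U => U in u0 B *; first by case: (no u0).
move=> /pcard_leP/injfunPex[f fAB fI]; exists f; split=> // x y Ax Ay.
by apply: fI; apply/mem_set.
Qed.

Lemma card_le_funTP (S U : Type) (B : set U) :
  [set: S] #<= B <-> exists f : S -> U, injective f /\ forall x, B (f x).
Proof.
split=> [/card_leP[f]|[f [fI fB]]]; last first.
  by apply: (@injfun_card_le _ _ _ _ f) => // x y _ _ /fI.
pose j x : set_type [set: S] := SigSub (mem_set (I : [set: S] x)).
exists (fun x => val (f (j x))); split=> [x y /val_inj|x].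
  by move=> /(@inj _ _ _ f); rewrite !inE => /(_ I I) -[].
exact/set_mem/valP.
Qed.

Lemma card_eq_bijfun (S U : Type) (u0 : U) (A : set S) (B : set U) :
  A #= B -> exists f : S -> U,
    [/\ forall x, A x -> B (f x),
        forall x y, A x -> A y -> f x = f y -> x = y &
        forall y, B y -> exists2 x, A x & f x = y].
Proof.
elim/Ppointed: U => U in u0 B *; first by case: (no u0).
move=> /card_set_bijP[f [fAB fI fS]]; exists f; split=> // x y Ax Ay.
by apply: fI; apply/mem_set.
Qed.

Lemma card_le_bijective (S U : Type) (f : S -> U) (g : U -> S) :
  injective f -> injective g -> exists h : S -> U, bijective h.
Proof.
move=> fI gI.
have [x0|noS] := pselect (exists x : S, True); last first.
  exists f; apply: inj_surj_bijective => // y.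
  by case: noS; exists (g y).
case: x0 => x0 _.
have : [set: S] #= [set: U].
  by rewrite card_eq_le; apply/andP; split; apply/card_le_funTP;
    [exists f | exists g].
move=> /(card_eq_bijfun (f x0))[h [_ hI hS]].
exists h; apply: inj_surj_bijective => [x y|y]; first exact: hI.
by have [//|x _ <-] := hS y; exists x.
Qed.

(** Zorn's lemma on graphs of partial injections from [A] to [B]: a maximal graph is defined on all
    of [A] or covers all of [B], since otherwise a fresh pair could be added. *)
Lemma card_le_total (S U : Type) (A : set S) (B : set U) :
  A #<= B \/ B #<= A.
Proof.
pose P (G : set (S * U)) := [/\ forall x y, G (x, y) -> A x /\ B y,
  forall x y y', G (x, y) -> G (x, y') -> y = y' &
  forall x x' y, G (x, y) -> G (x', y) -> x = x'].
have chainP F : F `<=` P -> total_on F subset -> P (\bigcup_(X in F) X).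
  move=> FP Ftot; split.
  - by move=> x y [X FX]; have [h _ _] := FP _ FX; exact: h.
  - move=> x y y' [X FX Xxy] [Y FY Yxy'].
    by case: (Ftot _ _ FX FY) => XY;
      [have [_ h _] := FP _ FY|have [_ h _] := FP _ FX];
      apply: (h x) => //; apply: XY.
  - move=> x x' y [X FX Xxy] [Y FY Yxy'].
    by case: (Ftot _ _ FX FY) => XY;
      [have [_ _ h] := FP _ FY|have [_ _ h] := FP _ FX];
      apply: (h _ _ y) => //; apply: XY.
have [G [[GAB Gfun Ginj] Gmax]] := Zorn_bigcup chainP.
have [domG|/existsNP[a /not_implyP[Aa noa]]] :=
    pselect (forall x, A x -> exists y, G (x, y)).
  left; have [f fG] : exists f : set_type A -> U, forall x, G (val x, f x).
    apply: (@fun_choice _ _ (fun (x : set_type A) y => G (val x, y))) => x.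
    by apply: domG; apply/set_mem/valP.
  rewrite -(card_le_eql (card_setT A)).
  apply/card_le_funTP; exists f; split=> [x y fxy|x]; last first.
    by have [] := GAB _ _ (fG x).
  by apply/val_inj/(Ginj _ _ (f x)) => //; rewrite fxy.
have [ranG|/existsNP[b /not_implyP[Bb nob]]] :=
    pselect (forall y, B y -> exists x, G (x, y)).
  right; have [f fG] : exists f : set_type B -> S, forall y, G (f y, val y).
    apply: (@fun_choice _ _ (fun (y : set_type B) x => G (x, val y))) => y.
    by apply: ranG; apply/set_mem/valP.
  rewrite -(card_le_eql (card_setT B)).
  apply/card_le_funTP; exists f; split=> [x y fxy|x]; last first.
    by have [] := GAB _ _ (fG x).
  by apply/val_inj/(Gfun (f x)) => //; rewrite fxy.
case: (Gmax (G `|` [set (a, b)])).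
  split; first by move=> p; left.
  by move=> /(_ (a, b) (or_intror erefl)) Gab; apply: noa; exists b.
split.
- by move=> x y [/GAB//|[-> ->]].
- move=> x y y' [Gxy|[-> ->]] [Gxy'|].
  + exact: (Gfun x).
  + by case=> xa _; case: noa; exists y; rewrite -xa.
  + by case: noa; exists y'.
  + by case.
- move=> x x' y [Gxy|[-> ->]] [Gxy'|].
  + exact: (Ginj _ _ y).
  + by case=> _ yb; case: nob; exists x; rewrite -yb.
  + by case: nob; exists x'.
  + by case.
Qed.

(* By Zorn's lemma there is a maximal [B] (with two distinct elements) carrying
   an injection [g] of its square. Two copies of [B] then embed in [B]; if the
   complement of [B] embeds in [B], so does [T], and otherwise [g] extends to
   the union of [B] and a disjoint copy of it. *)
Theorem infinite_square_inj (T : Type) : infinite_set [set: T] ->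
  exists h : T * T -> T, injective h.
Proof.
move=> /infiniteP/card_le_funTP[i [iI _]].
pose good (p : set T * (T * T -> T)) := [/\
  exists x y, [/\ p.1 x, p.1 y & x <> y],
  forall x y, p.1 x -> p.1 y -> p.1 (p.2 (x, y)) &
  forall x y x' y', p.1 x -> p.1 y -> p.1 x' -> p.1 y' ->
    p.2 (x, y) = p.2 (x', y') -> x = x' /\ y = y'].
(* Off the square of its set the function takes arbitrary values, so only values on that square are
   compared and [R] is merely a preorder. *)
pose R (s t : {p | good p}) := `[< (sval s).1 `<=` (sval t).1 /\
  forall x y, (sval s).1 x -> (sval s).1 y ->
    (sval s).2 (x, y) = (sval t).2 (x, y) >].
have [i' i'K] : exists i' : T -> nat, cancel i i'.
  have [i' i'P] : exists i' : T -> nat, forall x,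
      (exists n, i n = x) -> i (i' x) = x.
    apply: (@fun_choice _ _ (fun x m => (exists n, i n = x) -> i m = x)) => x.
    have [[n <-]|no] := pselect (exists n, i n = x); first by exists n.
    by exists 0 => /no.
  by exists i' => n; apply/iI/i'P; exists n.
have good0 : good (range i, fun p => i (pickle (i' p.1, i' p.2))).
  split.
  - by exists (i 0), (i 1); split; [exists 0|exists 1|move=> /iI].
  - by move=> x y _ _; exists (pickle (i' x, i' y)).
  - move=> _ _ _ _ [m _ <-] [n _ <-] [m' _ <-] [n' _ <-] /=.
    by rewrite !i'K => /iI /(pcan_inj pickleK) [-> ->].
have Rxx t : R t t by apply/asboolP; split.
have Rtr r s t : R r s -> R s t -> R r t.
  move=> /asboolP[rs1 rs2] /asboolP[st1 st2]; apply/asboolP; split.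
    exact: subset_trans st1.
  by move=> x y rx ry; rewrite rs2 // st2 //; apply: rs1.
have chainR (F : set {p | good p}) :
    total_on F R -> exists t, forall s, F s -> R s t.
  move=> Ftot; have [[s0 Fs0]|noF] := pselect (exists s, F s); last first.
    by exists (exist _ _ good0) => s Fs; case: noF; exists s.
  pose B : set T := [set x | exists2 s, F s & (sval s).1 x].
  have [g gP] : exists g : T * T -> T, forall p s, F s -> (sval s).1 p.1 ->
      (sval s).1 p.2 -> (sval s).2 p = g p.
    apply: (@fun_choice _ _ (fun p z => forall s, F s -> (sval s).1 p.1 ->
      (sval s).1 p.2 -> (sval s).2 p = z)) => -[x y] /=.
    have [[s [Fs sx sy]]|no] :=
      pselect (exists s, [/\ F s, (sval s).1 x & (sval s).1 y]); last first.
      by exists x => s Fs sx sy; case: no; exists s.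
    exists ((sval s).2 (x, y)) => t Ft tx ty.
    by case: (Ftot _ _ Fs Ft) => /asboolP[_ ->].
  have common x y : B x -> B y -> exists2 s, F s & (sval s).1 x /\ (sval s).1 y.
    move=> [s Fs sx] [t Ft ty].
    case: (Ftot _ _ Fs Ft) => /asboolP[st _].
      by exists t => //; split; first exact: st.
    by exists s => //; split=> //; apply: st.
  have goodB : good (B, g).
    split.
    - have [[x [y [sx sy xy]]] _ _] := svalP s0.
      by exists x, y; split=> //; exists s0.
    - move=> x y Bx By; have [s Fs [sx sy]] := common _ _ Bx By.
      exists s => //=; rewrite -(gP (x, y) s Fs sx sy).
      by have [_ h _] := svalP s; apply: h.
    - move=> x y x' y' /= Bx By Bx' By'.
      have [s Fs [sx sy]] := common _ _ Bx By.
      have [t Ft [tx' ty']] := common _ _ Bx' By'.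
      rewrite -(gP (x, y) s) // -(gP (x', y') t) //.
      case: (Ftot _ _ Fs Ft) => /asboolP[st E].
        have [_ _ h] := svalP t; rewrite E //.
        by apply: h => //; apply: st.
      have [_ _ h] := svalP s; rewrite E //.
      by apply: h => //; apply: st.
  exists (exist _ _ goodB) => s Fs; apply/asboolP; split=> [x sx|x y sx sy] /=.
    by exists s.
  exact: gP.
have [[[B g] goodBg] tmax] := ZL_preorder (exist _ _ good0) Rxx Rtr chainR.
have {}tmax B' h : good (B', h) -> B `<=` B' ->
    (forall x y, B x -> B y -> g (x, y) = h (x, y)) -> B' `<=` B.
  move=> goodB' BB' gh.
  have /asboolP[] // : R (exist _ _ goodB') (exist _ _ goodBg).
  by apply: tmax; apply/asboolP.
case: goodBg => -[q0 [q1 [/= Bq0 Bq1 q01]]] gB gI.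
have [|] := card_le_total (~` B) B.
  move=> /(card_le_injfun q0)[c [cB cI]].
  (* [T] embeds in [B]: the tag [q0] or [q1] tells whether a point lies in [B], and [c] folds the
     complement into [B]. *)
  pose k x := if pselect (B x) then g (q0, x) else g (q1, c x).
  have kB x : B (k x).
    by rewrite /k; case: pselect => Bx; apply: (gB) => //; apply: cB.
  have kI : injective k.
    move=> x y; rewrite /k; case: pselect => Bx; case: pselect => By /gI.
    - by case.
    - by case=> //; apply: cB.
    - by case=> //; [apply: cB|move=> /esym].
    - by case; [| exact: cB | | exact: cB | move=> _ /cI ->].
  exists (fun p => g (k p.1, k p.2)) => -[x y] [x' y'] /= /gI.
  by case=> // /kI -> /kI ->.
move=> /(card_le_injfun q0)[c [cB cI]]; exfalso.
pose B' : set T := B `|` c @` B.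
have [r rP] : exists r : T -> T, forall x, (B x -> r x = x) /\
    (~ B x -> B' x -> B (r x) /\ c (r x) = x).
  apply: (@fun_choice _ _ (fun x z => (B x -> z = x) /\
    (~ B x -> B' x -> B z /\ c z = x))) => x.
  have [Bx|nBx] := pselect (B x); first by exists x.
  have [[//|[y By yx]]|nBx'] := pselect (B' x); first by exists y.
  by exists x.
have rB x : B' x -> B (r x).
  move=> B'x; have [Bx|nBx] := pselect (B x); first by rewrite (rP x).1.
  by have [] := (rP x).2 nBx B'x.
pose e x := if pselect (B x) then q0 else q1.
have eB x : B (e x) by rewrite /e; case: pselect.
have erI x y : B' x -> B' y -> e x = e y -> r x = r y -> x = y.
  rewrite /e; case: pselect => Bx; case: pselect => By B'x B'y //.
  - by rewrite (rP x).1 // (rP y).1.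
  - by move=> /esym.
  - move=> _ rxy; have [_ <-] := (rP x).2 Bx B'x.
    by rewrite rxy; have [_ ->] := (rP y).2 By B'y.
(* A new pair is coded in [B] by its tags [e] and representatives [r], then sent by [c] outside [B],
   where it cannot collide with a value of [g]. *)
pose h (p : T * T) := if pselect (B p.1 /\ B p.2) then g p else
  c (g (g (e p.1, e p.2), g (r p.1, r p.2))).
have goodB' : good (B', h).
  have inB x y : B' x -> B' y -> B (g (g (e x, e y), g (r x, r y))).
    by move=> B'x B'y; apply: (gB); apply: (gB) => //; apply: rB.
  split.
  - by exists q0, q1; split=> //; left.
  - move=> x y B'x B'y; rewrite /= /h; case: pselect => [[Bx By]|nxy].
      by left; apply: (gB).
    by right; exists (g (g (e x, e y), g (r x, r y))) => //; apply: inB.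
  - move=> x y x' y' /= B'x B'y B'x' B'y'; rewrite /h /=.
    case: pselect => [[Bx By]|nxy]; case: pselect => [[Bx' By']|nxy'] /=.
    + exact: gI.
    + move=> E; have := cB _ (inB _ _ B'x' B'y'); rewrite -E.
      by case; apply: (gB).
    + by move=> E; have := cB _ (inB _ _ B'x B'y); rewrite E; case; apply: (gB).
    + move=> /cI /= /(_ (inB _ _ B'x B'y) (inB _ _ B'x' B'y')) /gI [].
      * exact: gB.
      * by apply: (gB); apply: rB.
      * exact: gB.
      * by apply: (gB); apply: rB.
      move=> /gI[] // exx' eyy' /gI[]; do ?exact: rB.
      by move=> rxx' ryy'; split; apply: erI.
have := cB _ Bq0; apply; apply: (tmax _ _ goodB'); last by right; exists q0.
  by move=> x Bx; left.
by move=> x y Bx By; rewrite /h /=; case: pselect => // -[].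
Qed.

Lemma infinite_prod_bijective (T I : Type) (i0 : I) (k : I -> T) :
  infinite_set [set: T] -> injective k ->
  exists f : T * I -> T, bijective f.
Proof.
move=> /infinite_square_inj[h hI] kI.
apply: (@card_le_bijective _ _ (fun p => h (p.1, k p.2)) (fun x => (x, i0))).
  by move=> [x i] [y j] /hI[-> /kI ->].
by move=> x y [].
Qed.

Lemma infinite_prod_count_bijective (T : Type) (I : countType) (i0 : I) :
  infinite_set [set: T] -> exists f : T * I -> T, bijective f.
Proof.
move=> Tinf; have /infiniteP/card_le_funTP[i [iI _]] := Tinf.
apply: (@infinite_prod_bijective _ _ i0 (i \o pickle)) => // x y /iI.
exact: (pcan_inj pickleK).
Qed.

(* If [T * T] is covered by two sets, either the first one meets every column
   [{x} * T], or the second one contains a whole column. *)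
Lemma card_le_setU_infinite (T S : Type) (A B : set S) :
  infinite_set [set: T] -> [set: T] #<= A `|` B ->
  [set: T] #<= A \/ [set: T] #<= B.
Proof.
move=> /infinite_square_inj[h hI] /card_le_funTP[j [jI jAB]].
have [/fun_choice[y yA]|/existsNP[x nA]] :=
    pselect (forall x, exists y, A (j (h (x, y)))); [left|right].
  apply/card_le_funTP; exists (fun x => j (h (x, y x))); split=> // x x'.
  by move=> /jI/hI[].
apply/card_le_funTP; exists (fun y => j (h (x, y))); split.
  by move=> y y' /jI/hI[].
by move=> y; have [Ay|//] := jAB (h (x, y)); case: nA; exists y.
Qed.

(** Both complements have the cardinality of [T]: [f] and [g] bound them above, the assumed
    embeddings of [T] below. Any bijection between them completes [p]. *)
Lemma extend_bijective (T S U : Type) (u0 : U) (f : S -> T) (g : U -> T)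
    (A : set S) (p : S -> U) :
  injective f -> injective g ->
  [set: T] #<= ~` A -> [set: T] #<= ~` (p @` A) ->
  (forall x y, A x -> A y -> p x = p y -> x = y) ->
  exists2 h : S -> U, bijective h & forall x, A x -> h x = p x.
Proof.
move=> fI gI TA TpA pI.
have eqT (V : Type) (k : V -> T) (C : set V) :
    injective k -> [set: T] #<= C -> C #= [set: T].
  move=> kI TC; rewrite card_eq_le TC andbT.
  by apply: (@injfun_card_le _ _ _ _ k) => // x y _ _ /kI.
have : ~` A #= ~` (p @` A).
  exact: card_eq_trans (eqT _ _ _ fI TA) (card_esym (eqT _ _ _ gI TpA)).
move=> /(card_eq_bijfun u0)[r [rA rI rS]].
exists (fun x => if pselect (A x) then p x else r x); last first.
  by move=> x Ax; case: pselect.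
apply: inj_surj_bijective => [x y|y].
  case: pselect => Ax; case: pselect => Ay /= E.
  - exact: pI.
  - by case: (rA _ Ay); exists x.
  - by case: (rA _ Ax); exists y.
  - exact: rI.
have [[x Ax <-]|nAy] := pselect ((p @` A) y).
  by exists x; case: pselect.
have [x nAx <-] := rS _ nAy.
by exists x; case: pselect.
Qed.

(** * Subgroups containing a conjugacy class of full support *)

Section ConjugacyClass.
Variables (T : Type) (T_infinite : infinite_set [set: T]).
Variables (G : set (T -> T)) (G_subgroup : is_subgroup G).

Let G_comp f g : G f -> G g -> G (f \o g).
Proof. by case: G_subgroup => _ _ h _; apply: h. Qed.

Let G_inv f g : G f -> cancel f g -> cancel g f -> G g.
Proof. by case: G_subgroup => _ _ _; apply. Qed.

Definition twist (s s' : T -> T) (p : T * option bool) : T * option bool :=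
  match p.2 with
  | Some true => (s' p.1, p.2)
  | Some false => (s p.1, p.2)
  | None => p
  end.

(** * Commutators with a conjugate of a fixed permutation *)

Section Commutator.
Variables (S : Type) (q q' : S -> S) (qK : cancel q q') (q'K : cancel q' q).
Variables (f0 : S -> T) (f0_bij : bijective f0).
Variables (c : T -> S) (cI : injective c) (qc : forall x y, q (c x) <> c y).
Hypothesis G_conj : forall (f : S -> T) (f' : T -> S),
  cancel f f' -> cancel f' f -> G (f \o q \o f').

(* [twist s s'] is, in suitable coordinates, the commutator of [q] with the
   permutation acting as [s] on part of the image of [c] and trivially
   elsewhere. *)
Lemma twist_conj_mem (psi : T * option bool -> T) (psi' : T -> T * option bool)
    (s s' : T -> T) :
  cancel psi psi' -> cancel psi' psi -> cancel s s' -> cancel s' s ->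
  G (psi \o twist s s' \o psi').
Proof.
move=> psiK psi'K sK s'K.
have [e [e' eK e'K]] := infinite_prod_count_bijective true T_infinite.
have [k [k' kK k'K]] :=
  infinite_prod_count_bijective (None : option bool) T_infinite.
have [x0 _] := infinite_setN0 T_infinite.
(* Only half of the range of [c] is used; the other half avoids the image of [p] below, which leaves
   room to extend [p] to a bijection. *)
pose c1 x := c (e (x, true)).
have c1I : injective c1 by move=> x y /cI /(can_inj eK) [].
have qI := can_inj qK.
pose p (z : T * option bool) := if z.2 == Some true then c1 z.1 else q (c1 z.1).
have [chi [chi' chiK chi'K] chiE] : exists2 chi : T * option bool -> S,
    bijective chi & forall z, z.2 <> None -> chi z = p z.
  apply: (@extend_bijective T _ _ (c x0) k f0 [set z | z.2 <> None]).
  - exact: can_inj kK.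
  - exact: bij_inj.
  - apply/card_le_funTP; exists (fun x => (x, None)).
    by split=> [x y []|x]; last exact.
  - apply/card_le_funTP; exists (fun x => c (e (x, false))); split.
      by move=> x y /cI /(can_inj eK) [].
    move=> x [[y o] _]; rewrite /p /=; case: ifP => _; last exact: qc.
    by move=> /cI /(can_inj eK).
  - move=> [x o] [y o']; rewrite /p /=.
    case: o => [[]|] //; case: o' => [[]|] //= _ _.
    + by move=> /c1I ->.
    + by move=> /esym /qc.
    + by move=> /qc.
    + by move=> /qI /c1I ->.
pose act (s : T -> T) (z : T * option bool) :=
  if z.2 == Some true then (s z.1, z.2) else z.
have actK (r r' : T -> T) : cancel r r' -> cancel (act r) (act r').
  by move=> rK [x [[]|]]; rewrite /act //= rK.
pose g := chi \o act s \o chi'; pose g' := chi \o act s' \o chi'.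
have gK : cancel g g' by move=> x; rewrite /g /g' /= chiK actK.
have g'K : cancel g' g by move=> x; rewrite /g /g' /= chiK actK.
have g_fix w : (forall x, w <> c1 x) -> g w = w.
  move=> nw; rewrite /g /=; case E : (chi' w) => [x [[]|]].
  - by case: (nw x); rewrite -(chi'K w) E chiE.
  - by rewrite /act /= -E chi'K.
  - by rewrite /act /= -E chi'K.
(* On [Some true] only [g'] acts, because [q'] leads out of the range of [c1]; on [Some false] only
   [g] acts; on [None] neither does. *)
have commE z : q (g (q' (g' (chi z)))) = chi (twist s s' z).
  rewrite /g' /= chiK; case: z => x [[]|] /=; rewrite /act /twist /=.
  - rewrite chiE //= /p /= g_fix ?q'K // => y E.
    by apply: (@qc (e (y, true)) (e (s' x, true))); rewrite -/(c1 y) -E q'K.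
  - by rewrite !chiE // /p /= qK /g /= -[c1 x]/(p (x, Some true)) -chiE // chiK
         /act /= chiE.
  - rewrite g_fix ?q'K // => y E.
    have : chi (x, None) = chi (y, Some false).
      by rewrite [RHS]chiE // /p /= -E q'K.
    by move=> /(can_inj chiK).
(* Membership in [G] comes from writing the commutator as the conjugate of [q] by [f] times the
   inverse of its conjugate by [f \o g]. *)
pose f := psi \o chi'; pose f' := chi \o psi'.
have fK : cancel f f' by move=> x; rewrite /f /f' /= psiK chi'K.
have f'K : cancel f' f by move=> x; rewrite /f /f' /= chiK psi'K.
have fgK : cancel (f \o g) (g' \o f') by apply: can_comp.
have fg'K : cancel (g' \o f') (f \o g) by apply: can_comp.
have Ginv : G (f \o g \o q' \o (g' \o f')).
  apply: (G_inv (G_conj fgK fg'K)) => x /=.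
    by rewrite fK gK qK g'K f'K.
  by rewrite fK gK q'K g'K f'K.
have := G_comp (G_conj fK f'K) Ginv; congr G; apply/funext => x /=.
by rewrite fK /f' /= commE /f /= chiK.
Qed.

End Commutator.

(** * From twists to all permutations *)

Section FullTwist.
Hypothesis twist_mem :
  forall (psi : T * option bool -> T) (psi' : T -> T * option bool) s s',
  cancel psi psi' -> cancel psi' psi -> cancel s s' -> cancel s' s ->
  G (psi \o twist s s' \o psi').

Let I := (nat * option bool)%type.

Definition column (s : T -> T) (p : T * I) : T * I :=
  if p.2 == (0, Some true) then (s p.1, p.2) else p.

(* [shift] moves the columns one step along the two-sided sequence
   ..., (1, None), (0, None), (0, Some true), (0, Some false), (1, Some true),
   (1, Some false), ... *)
Let shift (i : I) : I :=
  match i.2 with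
  | Some true => (i.1, Some false)
  | Some false => (i.1.+1, Some true)
  | None => if i.1 is n.+1 then (n, None) else (0, Some true)
  end.

Let unshift (i : I) : I :=
  match i.2 with
  | Some false => (i.1, Some true)
  | Some true => if i.1 is n.+1 then (n, Some false) else (0, None)
  | None => (i.1.+1, None)
  end.

Let shiftK : cancel shift unshift.
Proof. by move=> [[|n] [[]|]]. Qed.

Let unshiftK : cancel unshift shift.
Proof. by move=> [[|n] [[]|]]. Qed.

(* An Eilenberg swindle: multiply (..., 1, 1, s, s', s, s', ...) by its shifted
   inverse (..., 1, 1, 1, s, s', s, ...); only the first column survives. *)
Lemma column_conj_mem (theta : T * I -> T) (theta' : T -> T * I) s s' :
  cancel theta theta' -> cancel theta' theta -> cancel s s' -> cancel s' s ->
  G (theta \o column s \o theta').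
Proof.
move=> thetaK theta'K sK s'K.
have [k [k' kK k'K]] := infinite_prod_count_bijective 0 T_infinite.
(* Identifying [T] with [T * nat] splits each copy of [T] into countably many columns, so that one
   twist acts on all of them at once. *)
pose lift (r : T -> T) t := k (r (k' t).1, (k' t).2).
have liftK r r' : cancel r r' -> cancel (lift r) (lift r').
  by move=> rK t; rewrite /lift kK /= rK -surjective_pairing k'K.
pose psi (j : I -> I) (z : T * option bool) :=
  theta ((k' z.1).1, j ((k' z.1).2, z.2)).
pose psi' (j' : I -> I) t := let: (x, i) := theta' t in
  (k (x, (j' i).1), (j' i).2).
have psiK j j' : cancel j j' -> cancel (psi j) (psi' j').
  move=> jK [t o]; rewrite /psi /psi' thetaK jK /=.
  by rewrite -surjective_pairing k'K.
have psi'K j j' : cancel j' j -> cancel (psi' j') (psi j).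
  move=> j'K t; rewrite /psi /psi'; case E : (theta' t) => [x i] /=.
  by rewrite kK -surjective_pairing j'K /= -E theta'K.
have E j j' r r' : cancel j j' -> cancel j' j -> cancel r r' -> cancel r' r ->
    G (psi j \o twist (lift r) (lift r') \o psi' j').
  by move=> jK j'K rK r'K; apply: twist_mem; auto.
(* The first factor acts by [s] on the columns [(n, Some true)] and by [s'] on [(n, Some false)];
   the second is this pattern moved by [shift]. They cancel except on [(0, Some true)], which
   [shift] reaches from the idle column [(0, None)]. *)
have := G_comp (E id id s' s (fun=> erefl) (fun=> erefl) s'K sK)
  (E shift unshift s' s shiftK unshiftK s'K sK).
congr G; apply/funext => t /=; rewrite -{1 2}(theta'K t).
case: (theta' t) => x i; rewrite /psi /psi' thetaK /column.
case: i => [[|n] [[]|]]; rewrite /twist /lift /= ?kK /= ?thetaK /= ?kK /= ?kK /=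
  ?thetaK ?kK /= ?kK //= ?sK ?s'K //.
Qed.

(** Half of a large set of fixed points is reserved to fill all columns but one; the rest of [T]
    becomes the remaining column, on which [u] acts. *)
Lemma large_fixed_mem (u u' : T -> T) : cancel u u' -> cancel u' u ->
  [set: T] #<= [set x | u x = x] -> G u.
Proof.
move=> uK u'K /card_le_funTP[j [jI uj]].
have [e [e' eK e'K]] := infinite_prod_count_bijective true T_infinite.
have [k [k' kK _]] := infinite_prod_count_bijective (0, Some true) T_infinite.
have [x0 _] := infinite_setN0 T_infinite.
(* The fixed points tagged [true] are reserved; those tagged [false] keep [M] as large as [T]. *)
pose M : set T := [set x | forall y, x <> j (e (y, true))].
have [m [mM mI mS]] : exists m : T -> T, [/\ forall x, M (m x), injective m &
    forall y, M y -> exists x, m x = y].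
  have : [set: T] #= M.
    rewrite card_eq_le card_leT andbT; apply/card_le_funTP.
    exists (fun y => j (e (y, false))); split=> [x y /jI/(can_inj eK)[]//|x y].
    by move=> /jI/(can_inj eK).
  move=> /(card_eq_bijfun x0)[m [mM mI mS]]; exists m; split.
  - by move=> x; apply: mM.
  - by move=> x y; apply: mI.
  - by move=> y /mS[x _ <-]; exists x.
have uM x : M x -> M (u x).
  by move=> Mx y; rewrite -uj => /(can_inj uK); apply: Mx.
have u'M x : M x -> M (u' x).
  by move=> Mx y /(congr1 u); rewrite u'K uj; apply: Mx.
have [theta [theta' thetaK theta'K] thetaE] : exists2 theta : T * I -> T,
    bijective theta & forall z, z.2 = (0, Some true) -> theta z = m z.1.
  apply: (@extend_bijective T _ _ x0 k id [set z | z.2 = (0, Some true)]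
    (fun z => m z.1)) => //.
  - exact: can_inj kK.
  - apply/card_le_funTP; exists (fun x => (x, (0, None))).
    by split=> [x y []|].
  - apply/card_le_funTP; exists (fun y => j (e (y, true))).
    split=> [x y /jI/(can_inj eK)[]//|y [z _ mz]].
    exact: (mM z.1 y).
  - by move=> [x i] [y i'] /= -> -> /mI ->.
have thetam y : theta (y, (0, Some true)) = m y by rewrite thetaE.
pose s (v : T -> T) x := (theta' (v (m x))).1.
have sE v : (forall x, M x -> M (v x)) -> forall x, m (s v x) = v (m x).
  move=> vM x; have [y yE] := mS _ (vM _ (mM x)).
  by rewrite /s -yE -{1}(thetam y) thetaK.
have sK : cancel (s u) (s u') by move=> x; apply: mI; rewrite !sE // uK.
have s'K : cancel (s u') (s u) by move=> x; apply: mI; rewrite !sE // u'K.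
have := column_conj_mem thetaK theta'K sK s'K.
congr G; apply/funext => t /=; rewrite -{2}(theta'K t).
case: (theta' t) => x i; rewrite /column /=; case: eqP => [->|ni].
  by rewrite !thetam sE.
have [Mt|] := pselect (M (theta (x, i))).
  have [y] := mS _ Mt; rewrite -thetam.
  by move=> /(can_inj thetaK)[_ /esym].
by move=> /existsNP[y /contrapT ->]; rewrite uj.
Qed.

(* Among three large disjoint sets [X1], [X2], [Y], the image by [u] of [X1] or
   of [X2] misses a large part of [Y]: this gives a large [b] such that a large
   [z] avoids both [b] and [u b]. A permutation [v] equal to [u] on [b] and
   trivial on half of [z] then reduces the claim to [v] and [v^-1 u]. *)
Lemma sym_sub_mem : sym T `<=` G.
Proof.
move=> u [u' uK u'K]; have uI := can_inj uK.
have [e [e' eK _]] :=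
  infinite_prod_count_bijective (None : option bool) T_infinite.
have eI := can_inj eK.
have [b [z [bI zI zb zub]]] : exists b z : T -> T, [/\ injective b, injective z,
    forall x y, z x <> b y & forall x y, z x <> u (b y)].
  pose Y : set T := [set y | exists x, y = e (x, None)].
  pose uX : set T := [set y | exists x, y = u (e (x, Some true))].
  have : [set: T] #<= (Y `&` uX) `|` (Y `\` uX).
    apply/card_le_funTP; exists (fun x => e (x, None)).
    split=> [x y /eI[]//|x].
    have [|] := pselect (uX (e (x, None))); [left|right].
      by split=> //; exists x.
    by split=> //; exists x.
  (* If a large part of [Y] lies in [uX], it misses the image of the copy [Some false], so [b] runs
     over that copy; otherwise [b] runs over [Some true]. *)
  move=> /(card_le_setU_infinite T_infinite)[] /card_le_funTP[z [zI zY]].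
    exists (fun x => e (x, Some false)), z; split=> //.
    - by move=> x y /eI[].
    - by move=> x y; have [[t ->] _] := zY x; move=> /eI.
    - by move=> x y; have [_ [t ->]] := zY x; move=> /uI/eI.
  exists (fun x => e (x, Some true)), z; split=> //.
  - by move=> x y /eI[].
  - by move=> x y; have [[t ->] _] := zY x; move=> /eI.
  - by move=> x y E; have [_] := zY x; apply; exists y.
have [e2 [e2' e2K _]] := infinite_prod_count_bijective true T_infinite.
(* [v] will fix the half [c]; the half [d] avoids both the prescribed domain and its image, which
   leaves room for the extension. *)
pose c x := z (e2 (x, true)); pose d x := z (e2 (x, false)).
have cd x y : c x <> d y by move=> /zI/(can_inj e2K).
have [x0 _] := infinite_setN0 T_infinite.
pose p x := if pselect (exists y, x = b y) then u x else x.
have pb y : p (b y) = u (b y).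
  by rewrite /p; case: pselect => // -[]; exists y.
have pc y : p (c y) = c y.
  by rewrite /p; case: pselect => // h; exfalso; case: h => t /zb.
have [v [v' vK v'K] vE] : exists2 v : T -> T, bijective v &
    forall x, (exists y, x = b y) \/ (exists y, x = c y) -> v x = p x.
  apply: (@extend_bijective T _ _ x0 id id
    [set x | (exists y, x = b y) \/ (exists y, x = c y)]) => //.
  - apply/card_le_funTP; exists d; split=> [x y /zI/(can_inj e2K)[]//|x].
    by case=> -[y]; [exact: zb | move=> /esym; exact: cd].
  - apply/card_le_funTP; exists d; split=> [x y /zI/(can_inj e2K)[]//|x].
    case=> t [] [y ->]; first by rewrite pb => /esym/zub.
    by rewrite pc => /cd.
  - move=> x y [] [s ->] [] [t ->]; rewrite ?pb ?pc //.
    + by move=> /uI.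
    + by move=> /esym/zub.
    + by move=> /zub.
have vb y : v (b y) = u (b y) by rewrite vE ?pb //; left; exists y.
have vc y : v (c y) = c y by rewrite vE ?pc //; right; exists y.
have Gv : G v.
  apply: (large_fixed_mem vK v'K); apply/card_le_funTP.
  by exists c; split=> // x y /zI/(can_inj e2K)[].
have Gw : G (v' \o u).
  apply: (@large_fixed_mem _ (u' \o v)); [exact: can_comp | exact: can_comp | ].
  by apply/card_le_funTP; exists b; split=> // x; rewrite /= -vb vK.
by have := G_comp Gv Gw; congr G; apply/funext => x /=; rewrite v'K.
Qed.

End FullTwist.
End ConjugacyClass.

(** * The sets W, K, R and S *)

Section Generation.
Variable Omega : Type.
Implicit Types X : set (Omega -> Omega).

Lemma is_subgroup_sym : is_subgroup (sym Omega).
Proof.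
split=> //=.
- exact: (Bijective (g := id)).
- by move=> f g fb gb; apply: bij_comp.
- by move=> f g _ fK gK; exists f.
Qed.

Lemma generatesP X : X `<=` sym Omega ->
  (forall H, is_subgroup H -> X `<=` H -> sym Omega `<=` H) -> generates X.
Proof.
move=> Xsym XH; apply/seteqP; split=> [f|f symf H [Hgrp HX]].
  by apply; split=> //; exact: is_subgroup_sym.
exact: XH symf.
Qed.

Lemma not_generates X H :
  is_subgroup H -> X `<=` H -> ~ (sym Omega `<=` H) -> ~ generates X.
Proof.
move=> Hgrp XH symH gen; apply: symH; rewrite -gen => f; apply; exact: conj.
Qed.

Variables alpha beta : Type.

Lemma S_sub_R : S_ Omega alpha beta `<=` R_ Omega alpha beta.
Proof.
move=> f [symf [P [Pf Pa Pb]]]; split=> //; exists P; split=> //.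
by have := Pa; rewrite card_eq_le => /andP[].
Qed.

Lemma S_sub_K : S_ Omega alpha beta `<=` K_ Omega alpha beta.
Proof.
move=> f [symf [P [Pf Pa Pb]]]; split=> //; exists P; split=> // U /Pb.
by rewrite card_eq_le => /andP[].
Qed.

Lemma R_sub_W : R_ Omega alpha beta `<=` W_ Omega alpha beta.
Proof.
move=> f [symf [P [Pf Pa Pb]]]; split=> //; exists P; split=> // U /Pb.
by rewrite card_eq_le => /andP[].
Qed.

Lemma K_sub_W : K_ Omega alpha beta `<=` W_ Omega alpha beta.
Proof.
move=> f [symf [P [Pf Pa Pb]]]; split=> //; exists P; split=> //.
by have := Pa; rewrite card_eq_le => /andP[].
Qed.

(** A moved point is coded by the index of a piece containing it and its position in that piece. *)
Lemma card_moved_W f : W_ Omega alpha beta f ->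
  moved f #<= [set: (alpha * beta)%type].
Proof.
move=> [_ [P [[Ptriv _ fP] Pa Pb]]].
(* A moved point is what supplies the default elements [a0] and [b0]. *)
have [[x0 fx0]|nof] := pselect (exists x, moved f x); last first.
  suff -> : moved f = set0 by exact: card_ge0.
  by apply/seteqP; split=> // x fx; case: nof; exists x.
have inh (S U : Type) (A : set S) x :
    A x -> A #<= [set: U] -> exists y : U, True.
  move=> Ax; rewrite -(card_le_eql (card_setT A)) => /card_le_funTP[i _].
  by exists (i (SigSub (mem_set Ax))).
have [V PV Vx0] : (\bigcup_(U in P) U) x0 by rewrite -fP.
have [a0 _] := inh _ _ _ _ PV Pa; have [b0 _] := inh _ _ _ _ Vx0 (Pb _ PV).
have [i [_ iI]] := card_le_injfun a0 Pa.
have [j jI] : exists j : set Omega -> Omega -> beta, forall U, P U ->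
    forall x y, U x -> U y -> j U x = j U y -> x = y.
  apply: (@fun_choice _ _ (fun U j => P U ->
    forall x y, U x -> U y -> j x = j y -> x = y)) => U.
  have [PU|nPU] := pselect (P U); last by exists (fun=> b0).
  by have [j [_ jI]] := card_le_injfun b0 (Pb _ PU); exists j.
have [U UP] : exists U : Omega -> set Omega, forall x, moved f x ->
    P (U x) /\ U x x.
  apply: (@fun_choice _ _ (fun x U => moved f x -> P U /\ U x)) => x.
  have [fx|nfx] := pselect (moved f x); last by exists set0.
  have [U PU Ux] : (\bigcup_(U in P) U) x by rewrite -fP.
  by exists U.
apply: (@injfun_card_le _ _ _ _ (fun x => (i (U x), j (U x) x))) => //.
move=> x y fx fy.
have [PUx Uxx] := UP _ fx; have [PUy Uyy] := UP _ fy.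
move=> [] /(iI _ _ PUx PUy) Uxy; rewrite -Uxy; apply: jI => //.
by rewrite Uxy.
Qed.

(** The pieces are the images of the fibres over [alpha]; they cover [Omega], all of which is moved.
    The point [b0] makes fibres nonempty, hence distinct for distinct indices. *)
Lemma fiberwise_perm_S (p p' : beta -> beta) (b0 : beta)
    (theta : alpha * beta -> Omega) (theta' : Omega -> alpha * beta) :
  cancel p p' -> cancel p' p -> (forall b, p b <> b) ->
  cancel theta theta' -> cancel theta' theta ->
  S_ Omega alpha beta (theta \o (fun z => (z.1, p z.2)) \o theta').
Proof.
move=> pK p'K pfix thetaK theta'K.
set f := _ \o theta'; have thetaI := can_inj thetaK.
pose U a : set Omega := range (fun b => theta (a, b)).
have UI a a' x : U a x -> U a' x -> a = a'.
  by move=> [b _ <-] [b' _ /thetaI[]].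
split.
  exists (theta \o (fun z => (z.1, p' z.2)) \o theta') => x; rewrite /f /=.
    by rewrite thetaK /= pK -surjective_pairing theta'K.
  by rewrite thetaK /= p'K -surjective_pairing theta'K.
exists (range U); split.
- split.
  + by move=> _ _ [a _ <-] [a' _ <-] [x [/= Ux U'x]]; rewrite (UI _ _ _ Ux U'x).
  + by move=> _ [a _ <-] _ [b _ <-]; exists (p b) => //; rewrite /f /= thetaK.
  + apply/seteqP; split=> x.
      move=> _; exists (U (theta' x).1); first by exists (theta' x).1.
      by exists (theta' x).2 => //; rewrite -surjective_pairing theta'K.
    move=> [_ [a _ <-]] [b _ <-]; rewrite /moved /f /= thetaK => /thetaI[].
    exact: pfix.
- apply: inj_card_eq => a a' _ _ Uaa'.
  have Ux : U a (theta (a, b0)) by exists b0.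
  by apply: (UI _ _ _ Ux); rewrite -Uaa'.
- move=> _ [a _ <-]; apply: inj_card_eq => b b' _ _ /thetaI[] //.
Qed.

(** Since [theta] is arbitrary in [fiberwise_perm_S], every conjugate of the fibrewise action of [p]
    lies in [S_]; the range of [c] is the large set disjoint from its image that the commutator
    argument requires. *)
Lemma S_generates X (theta : alpha * beta -> Omega) (p : beta -> beta)
    (c : Omega -> alpha * beta) :
  infinite_set [set: Omega] ->
  bijective theta -> bijective p -> (forall b, p b <> b) ->
  injective c -> (forall x y, ((c x).1, p (c x).2) <> c y) ->
  S_ Omega alpha beta `<=` X -> X `<=` sym Omega -> generates X.
Proof.
move=> Oinf theta_bij [p' pK p'K] pfix cI pc SX Xsym.
have [x0 _] := infinite_setN0 Oinf.
apply: generatesP => // H Hgrp XH.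
apply: sym_sub_mem => // psi psi' s s' psiK psi'K sK s'K.
apply: (@twist_conj_mem _ Oinf _ Hgrp _ (fun z => (z.1, p z.2))
  (fun z => (z.1, p' z.2)) _ _ _ theta_bij c) => //.
- by move=> [a b] /=; rewrite pK.
- by move=> [a b] /=; rewrite p'K.
- by move=> f f' fK f'K; apply/XH/SX/(fiberwise_perm_S (c x0).2 pK p'K).
Qed.

End Generation.

(** * Derangements, small supports and the final theorem *)

Lemma infinite_swap (T : Type) : infinite_set [set: T] ->
  exists (p : T -> T) (c : T -> T),
    [/\ bijective p, forall x, p x <> x, injective c &
        forall x y, p (c x) <> c y].
Proof.
move=> Tinf; have [e [e' eK e'K]] := infinite_prod_count_bijective true Tinf.
pose p x := e ((e' x).1, ~~ (e' x).2).
have pp : cancel p p.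
  by move=> x; rewrite /p eK /= negbK -surjective_pairing e'K.
exists p, (fun x => e (x, true)); split.
- by exists p.
- by move=> x; rewrite -{2}(e'K x) /p; case: (e' x) => y [] /(can_inj eK).
- by move=> x y /(can_inj eK)[].
- by move=> x y; rewrite /p eK /= => /(can_inj eK).
Qed.

Lemma derangement_exists (beta : Type) : `I_2 #<= [set: beta] ->
  exists p : beta -> beta, bijective p /\ forall b, p b <> b.
Proof.
move=> beta2; have [[n bn]|/infinite_swap] := pselect (finite_set [set: beta]);
  last by case=> p [_ [pb pfix _ _]]; exists p.
have n2 : (2 <= n)%N by rewrite -card_le_II -(card_le_eqr bn).
case: n n2 bn => [|[|n]] // _ bn.
have [f [_ fI fS]] := card_eq_bijfun ord0 (card_eq_trans bn card_II).
have [f' fK f'K] : bijective f.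
  apply: inj_surj_bijective => [x y|y]; first exact: fI.
  by have [//|x _ <-] := fS y; exists x.
exists (f' \o @ordS _ \o f); split.
  exists (f' \o @ord_pred _ \o f) => x /=; first by rewrite f'K ordSK fK.
  by rewrite f'K ord_predK fK.
move=> b /(congr1 f) /=; rewrite f'K => /(congr1 val) /=.
case: (f b) => i /=; rewrite ltnS leq_eqVlt => /orP[/eqP ->|lti].
  by rewrite modnn.
by rewrite modn_small ?ltnS // => /esym/n_Sn.
Qed.

(** The support of a composite lies in the union of the two supports, and [Omega] embeds in such a
    union only if it embeds in one of them. *)
Lemma is_subgroup_small_support (Omega : Type) : infinite_set [set: Omega] ->
  is_subgroup [set f : Omega -> Omega |
    sym Omega f /\ ~ ([set: Omega] #<= moved f)].
Proof.
move=> Oinf; split.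
- by move=> f [].
- split; first exact: (Bijective (g := id)).
  have [x0 _] := infinite_setN0 Oinf.
  by move=> /card_le_funTP[j [_ jP]]; case: (jP x0).
- move=> f g [fb nf] [gb ng]; split; first exact: bij_comp.
  move=> h; suff /(card_le_setU_infinite Oinf)[] :
    [set: Omega] #<= moved f `|` moved g by [].
  apply: card_le_trans h _; apply: subset_card_le => x fgx.
  have [gx|] := pselect (g x = x); last by right.
  by left; rewrite /moved /= -{1}gx.
- move=> f g [fb nf] fK gK; split; first by exists f.
  suff -> : moved g = moved f by [].
  by apply/seteqP; split=> x nx E; apply: nx; rewrite -{1}E ?fK ?gK.
Qed.

(** The lower bounds on [alpha] and [beta] are forced: without pieces nothing moves, and a one-point
    piece would be a fixed point among moved ones, so otherwise the sets contain at most the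
    identity. *)
Theorem theorem9 (Omega : Type) (Omega_infinite : infinite_set [set: Omega]) :
  [/\ (forall alpha beta : Type,
         card_lt [set: (alpha * beta)%type] [set: Omega] ->
         [/\ ~ generates (W_ Omega alpha beta),
             ~ generates (R_ Omega alpha beta),
             ~ generates (K_ Omega alpha beta) &
             ~ generates (S_ Omega alpha beta)]),
      (forall alpha : Type,
         `I_1 #<= [set: alpha] -> [set: alpha] #<= [set: Omega] ->
         [/\ generates (W_ Omega alpha Omega),
             generates (R_ Omega alpha Omega),
             generates (K_ Omega alpha Omega) &
             generates (S_ Omega alpha Omega)]) &
      (forall beta : Type,
         `I_2 #<= [set: beta] -> [set: beta] #<= [set: Omega] ->
         [/\ generates (W_ Omega Omega beta),
             generates (R_ Omega Omega beta),
             generates (K_ Omega Omega beta) &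
             generates (S_ Omega Omega beta)])].
Proof.
have [p [c [pb pfix cI pc]]] := infinite_swap Omega_infinite.
split.
- move=> alpha beta [le_ab ne_ab].
  set H := [set f : Omega -> Omega |
    sym Omega f /\ ~ ([set: Omega] #<= moved f)].
  have WH : W_ Omega alpha beta `<=` H.
    move=> f Wf; split=> [|big]; first by case: Wf.
    move/negP: ne_ab; apply; rewrite card_eq_le le_ab /=.
    exact: card_le_trans big (card_moved_W Wf).
  have gen X : X `<=` W_ Omega alpha beta -> ~ generates X.
    move=> XW.
    apply: (not_generates (is_subgroup_small_support Omega_infinite)).
      exact: subset_trans WH.
    move=> /(_ p pb)[_]; apply; apply/card_le_funTP.
    by exists id; split=> // x; apply: pfix.
  split; apply: gen => //.
  + exact: R_sub_W.
  + exact: K_sub_W.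
  + by apply: subset_trans (@K_sub_W _ _ _); exact: S_sub_K.
- move=> alpha alpha1 /card_le_funTP[k [kI _]].
  have [a0 _] : exists a : alpha, True.
    have : [set: 'I_1] #<= [set: alpha] by rewrite -(card_le_eql card_II).
    by move=> /card_le_funTP[f _]; exists (f ord0).
  have [th th_bij] := infinite_prod_bijective a0 Omega_infinite kI.
  have gen X : S_ Omega alpha Omega `<=` X -> X `<=` sym Omega -> generates X.
    (* Each fibre is a copy of [Omega], so the one over [a0] already contains a large set disjoint
       from its image. *)
    apply: (@S_generates _ _ _ _ (th \o (fun z => (z.2, z.1))) p
      (fun x => (a0, c x))) => //.
    + by apply: bij_comp => //; exists (fun z => (z.2, z.1)) => -[].
    + by move=> x y [/cI].
    + by move=> x y [] /pc.
  split; apply: gen; do ?[exact: S_sub_R | exact: S_sub_K | by move=> f []].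
  by apply: subset_trans (@R_sub_W _ _ _); exact: S_sub_R.
- move=> beta beta2 /card_le_funTP[k [kI _]].
  have [q [qb qfix]] := derangement_exists beta2.
  have [b0 _] : exists b : beta, True.
    have : [set: 'I_2] #<= [set: beta] by rewrite -(card_le_eql card_II).
    by move=> /card_le_funTP[f _]; exists (f ord0).
  have [th th_bij] := infinite_prod_bijective b0 Omega_infinite kI.
  have gen X : S_ Omega Omega beta `<=` X -> X `<=` sym Omega -> generates X.
    (* Fibres may be small here, so the large set takes the point [b0] from every fibre; [q] moves
       [b0]. *)
    apply: (@S_generates _ _ _ _ th q (fun x => (x, b0))) => //.
    + by move=> x y [].
    + by move=> x y [_] /qfix.
  split; apply: gen; do ?[exact: S_sub_R | exact: S_sub_K | by move=> f []].
  by apply: subset_trans (@R_sub_W _ _ _); exact: S_sub_R.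
Qed.
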